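(* Let $\mathcal{H}$ be a real Hilbert space, let $I$ be a nonempty finite set, and put $q=\|\cdot\|_{\mathcal{H}}^2/2$. For every $i\in I$, let $\omega_i\in\left]0,+\infty\right[$, let $\mathcal{G}_i$ be a real Hilbert space, put $q_i=\|\cdot\|_{\mathcal{G}_i}^2/2$, let $\mathcal{K}_i$ be a real Hilbert space, let $L_i\colon\mathcal{H}\to\mathcal{G}_i$ and $M_i\colon\mathcal{K}_i\to\mathcal{G}_i$ be nonzero bounded linear operators, let $f_i\in\Gamma_0(\mathcal{G}_i)$, let $g_i\in\Gamma_0(\mathcal{G}_i)$, and let $h_i\in\Gamma_0(\mathcal{K}_i)$. Suppose that $\sum_{i\in I}\omega_i\|L_i\|^2\leq 1$ and that, for every $i\in I$, $$0\in\operatorname{sri}\big(\operatorname{dom}h_i^*-M_i^*(\operatorname{dom}f_i\cap\operatorname{dom}g_i^* )\big)\quad\text{and}\quad 0\in\operatorname{sri}(\operatorname{dom}f_i-\operatorname{dom}g_i^* ).$$ Set $$T=\sum_{i\in I}\omega_iL_i^*\circ\Big(\operatorname{prox}_{f_i}\mathbin{\square}\big(\partial g_i\mathbin{\square}(M_i\triangleright\partial h_i)\big)\Big)\circ L_i.$$ Then $T\in\mathcal{P}(\mathcal{H})$. More specifically, $T=\operatorname{prox}_f$, where $$f=\Bigg(\sum_{i\in I}\omega_i\Big(\big(f_i+g_i^*+h_i^*\circ M_i^*\big)^*\mathbin{\square} q_i\Big)\circ L_i\Bigg)^*-q.$$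
   Context: For a real Hilbert space $\mathcal{X}$: $\Gamma_0(\mathcal{X})$ is the class of lower semicontinuous convex functions $f\colon\mathcal{X}\to\left]-\infty,+\infty\right]$ with $\operatorname{dom}f=\{x\in\mathcal{X}\mid f(x)<+\infty\}\neq\varnothing$. For $f\in\Gamma_0(\mathcal{X})$, the proximity operator $\operatorname{prox}_f\colon\mathcal{X}\to\mathcal{X}$ maps $x$ to the unique minimizer over $y\in\mathcal{X}$ of $f(y)+\frac12\|x-y\|^2$; $\mathcal{P}(\mathcal{X})$ is the set of operators $T\colon\mathcal{X}\to\mathcal{X}$ such that $T=\operatorname{prox}_f$ for some $f\in\Gamma_0(\mathcal{X})$. The conjugate of $f$ is $f^*\colon u\mapsto\sup_{x\in\mathcal{X}}(\langle x\mid u\rangle-f(x))$. The subdifferential of $f$ is $\partial f\colon\mathcal{X}\to 2^{\mathcal{X}}\colon x\mapsto\{u\in\mathcal{X}\mid(\forall y\in\mathcal{X})\ \langle y-x\mid u\rangle+f(x)\leq f(y)\}$. The symbol $\square$ has two meanings: between functions it is the infimal convolution $(f\mathbin{\square}g)(x)=\inf_{y\in\mathcal{X}}(f(y)+g(x-y))$; between set-valued operators $A,B\colon\mathcal{X}\to 2^{\mathcal{X}}$ it is the parallel sum $A\mathbin{\square}B=(A^{-1}+B^{-1})^{-1}$, where $A^{-1}$ is the set-valued operator with graph $\{(u,x)\mid u\in Ax\}$. The parallel composition of $A\colon\mathcal{X}\to 2^{\mathcal{X}}$ by a bounded linear operator $M\colon\mathcal{X}\to\mathcal{Y}$ ($\mathcal{Y}$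 a real Hilbert space) is $M\triangleright A=(M\circ A^{-1}\circ M^* )^{-1}\colon\mathcal{Y}\to 2^{\mathcal{Y}}$, where $M^*$ is the adjoint of $M$. Single-valued operators are identified with set-valued operators having the same graph. For a convex set $C\subset\mathcal{X}$, the strong relative interior $\operatorname{sri}C$ is the set of $x\in C$ such that the cone generated by $C-x$ is a closed vector subspace of $\mathcal{X}$. *)

(* Defs.v *)
From HB Require Import structures.
From mathcomp Require Import all_boot all_order all_algebra.
From mathcomp Require Import all_classical all_reals all_analysis.

Set Implicit Arguments.
Unset Strict Implicit.
Unset Printing Implicit Defensive.

Import Order.TTheory GRing.Theory Num.Theory numFieldNormedType.Exports.

Local Open Scope classical_set_scope.
Local Open Scope ring_scope.

HB.mixin Record CompleteNormedModule_isHilbert (R : realType) V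
    of CompleteNormedModule R V := {
  inner : V -> V -> R ;
  innerC : forall x y, inner x y = inner y x ;
  innerDl : forall x y z, inner (x + y) z = inner x z + inner y z ;
  innerZl : forall a x y, inner (a *: x) y = a * inner x y ;
  inner_norm : forall x, inner x x = `|x| ^+ 2
}.

#[short(type="hilbertType")]
HB.structure Definition Hilbert (R : realType) :=
  {V of CompleteNormedModule R V & CompleteNormedModule_isHilbert R V}.

Section Functions.
Context {R : realType} {X : hilbertType R}.
Local Open Scope ereal_scope.
Implicit Types (f g : X -> \bar R) (C D : set X).

Definition dom f : set X := [set x | f x < +oo].

Record Gamma0 f : Prop := {
  Gamma0_gtNy : forall x, -oo < f x ;
  Gamma0_lsc : lower_semicontinuous f ;
  Gamma0_convex : forall (x y : X) (t : R), (0 < t < 1)%R ->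
    f (t *: x + (1 - t) *: y)%R <= t%:E * f x + (1 - t)%:E * f y ;
  Gamma0_proper : dom f !=set0
}.

Definition half_sq (x : X) : \bar R := (`|x| ^+ 2 / 2)%:E.

(* [get] picks an arbitrary minimizer; for f in Gamma0 it is the only one. *)
Definition prox f (x : X) : X :=
  get [set y | forall z, f y + half_sq (x - y)%R <= f z + half_sq (x - z)%R].

Definition prox_class : set (X -> X) :=
  [set T | exists2 f, Gamma0 f & T = prox f].

Definition conjugate f (u : X) : \bar R :=
  ereal_sup (range (fun x => (inner x u)%:E - f x)).

Definition infconv f g (x : X) : \bar R :=
  ereal_inf (range (fun y => f y + g (x - y)%R)).

Definition subdiff f (x : X) : set X :=
  [set u | forall y, (inner (y - x)%R u)%:E + f x <= f y].

Definition minkowski_sub C D : set X := [set (x - y)%R | x in C & y in D].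

Definition cone C : set X :=
  [set z | exists2 t : R, (0 < t)%R & exists2 x, C x & z = (t *: x)%R].

Definition sri C : set X :=
  [set x | C x /\ let K := cone (minkowski_sub C [set x]) in
                  closed K /\ submod_closed (mem K)].

End Functions.

Section BoundedOperators.
Context {R : realType} {X Y : hilbertType R}.

Definition bounded_operator (M : {linear X -> Y}) : Prop :=
  exists c : R, forall x, `|M x| <= c * `|x|.

Definition opnorm (M : X -> Y) : R :=
  sup [set `|M x| | x in [set x | `|x| <= 1]].

(* For M bounded and linear the vector picked by [get] exists (Riesz) and is
   unique. *)
Definition adjoint (M : X -> Y) (y : Y) : X :=
  get [set x | forall z, inner (M z) y = inner z x].

End BoundedOperators.

(* A set-valued operator from X to Y is a function X -> set Y. *)
Section SetValued.

Definition sv {X Y : Type} (T : X -> Y) : X -> set Y := fun x => [set T x].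

Definition svinv {X Y : Type} (A : X -> set Y) : Y -> set X :=
  fun y => [set x | A x y].

Definition svcomp {X Y Z : Type} (B : Y -> set Z) (A : X -> set Y) :
  X -> set Z := fun x => [set z | exists2 y, A x y & B y z].

Definition svadd {X : Type} {Y : zmodType} (A B : X -> set Y) : X -> set Y :=
  fun x => [set u + v | u in A x & v in B x].

Definition svscale {R : pzRingType} {X : Type} {Y : lmodType R} (a : R)
  (A : X -> set Y) : X -> set Y := fun x => [set a *: u | u in A x].

Definition svsum {I : finType} {X : Type} {Y : zmodType}
  (A : I -> X -> set Y) : X -> set Y :=
  fun x => [set \sum_i u i | u in [set u : I -> Y | forall i, A i x (u i)]].

Definition parsum {X Y : zmodType} (A B : X -> set Y) : X -> set Y :=
  svinv (svadd (svinv A) (svinv B)).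

Definition parcomp {R : realType} {X Y : hilbertType R} (M : X -> Y)
  (A : X -> set X) : Y -> set Y :=
  svinv (svcomp (sv M) (svcomp (svinv A) (sv (adjoint M)))).

End SetValued.

(* Main.v *)
(* Write [q] for half the squared norm and let
   [phi_i = f_i + g_i^* + h_i^* o M_i^*].  The qualification conditions give the
   sum rule [d phi_i = d f_i + d g_i^* + M_i o d h_i^* o M_i^*] (Attouch-Brezis);
   since [d g_i^* = (d g_i)^-1], the parallel sums in [T] are the resolvents
   [prox phi_i].  By Moreau's identity [prox phi_i] is the gradient of the
   infimal convolution of [phi_i^*] and [q], hence [T] is the gradient of
   [psi = sum_i w_i (phi_i^* [] q_i) o L_i].  As [sum_i w_i |L_i|^2 <= 1], [q - psi]
   is convex, and writing it as the supremum of its tangents exhibits [psi^* - q]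
   as a supremum of continuous affine functions; its prox is then [T].

   The sum rule follows from a subgradient at 0 of the perturbation function.
   Baire's theorem bounds that function near 0 on the closed subspace spanned by
   its domain; convexity turns this into a bound [>= mu - K |w|], and the prox of
   a sublinear function replaces the Hahn-Banach theorem. *)
Require Import Defs.
From mathcomp Require Import all_boot all_order all_algebra.
From mathcomp Require Import all_classical all_reals all_analysis.
From mathcomp Require Import ring lra.

Set Implicit Arguments.
Unset Strict Implicit.
Unset Printing Implicit Defensive.

Import Order.TTheory GRing.Theory Num.Theory numFieldNormedType.Exports.

Local Open Scope classical_set_scope.
Local Open Scope ring_scope.

(** * Hilbert spaces and lower semicontinuity *)

Lemma lipschitz_cont {R : realType} {V W : normedModType R} (A : V -> W) (c : R) :
  (forall x y, `|A x - A y| <= c * `|x - y|) -> continuous A.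
Proof.
move=> Ac x; apply/cvgrPdist_lt => e e0.
have c0 : 0 < `|c| + 1 by rewrite ltr_wpDl.
have d0 : 0 < e / (`|c| + 1) by rewrite divr_gt0.
near=> y.
have : `|x - y| < e / (`|c| + 1) by near: y; apply: cvgr_dist_lt.
rewrite ltr_pdivlMr// mulrC; apply: le_lt_trans.
by rewrite (le_trans (Ac _ _))// ler_wpM2r// (le_trans (ler_norm _))// lerDl.
Unshelve. all: by end_near.
Qed.

Section InnerProduct.
Context {R : realType} {X : hilbertType R}.
Implicit Types (x y z u : X) (a : R).

Lemma innerDr x y z : inner x (y + z) = inner x y + inner x z.
Proof. by rewrite innerC innerDl !(innerC x). Qed.

Lemma innerZr a x y : inner x (a *: y) = a * inner x y.
Proof. by rewrite innerC innerZl (innerC x). Qed.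

Lemma innerNl x y : inner (- x) y = - inner x y.
Proof. by rewrite -scaleN1r innerZl mulN1r. Qed.

Lemma innerNr x y : inner x (- y) = - inner x y.
Proof. by rewrite innerC innerNl innerC. Qed.

Lemma inner0l x : inner 0 x = 0.
Proof. by rewrite -(scale0r 0) innerZl mul0r. Qed.

Lemma inner0r x : inner x 0 = 0.
Proof. by rewrite innerC inner0l. Qed.

Definition innerE := (@innerDl R X, innerDr, innerNl, innerNr, @innerZl R X,
  innerZr, inner0l, inner0r).

Lemma inner_ge0 x : 0 <= inner x x.
Proof. by rewrite inner_norm exprn_ge0. Qed.

Lemma inner_eq0 x : inner x x = 0 -> x = 0.
Proof. by rewrite inner_norm => /eqP; rewrite sqrf_eq0 normr_eq0 => /eqP. Qed.

Lemma inner_suml (I : finType) (F : I -> X) y :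
  inner (\sum_i F i) y = \sum_i inner (F i) y.
Proof.
by apply: (big_morph (fun x => inner x y) (fun x z => innerDl x z y)); rewrite inner0l.
Qed.

Lemma inner_sumr (I : finType) (F : I -> X) y :
  inner y (\sum_i F i) = \sum_i inner y (F i).
Proof. by rewrite innerC inner_suml; apply: eq_bigr => i _; rewrite innerC. Qed.

Lemma inner_le_norm x y : inner x y <= `|x| * `|y|.
Proof.
have [->|x0] := eqVneq x 0; first by rewrite inner0l normr0 mul0r.
have [->|y0] := eqVneq y 0; first by rewrite inner0r normr0 mulr0.
have := inner_ge0 (`|y| *: x - `|x| *: y).
rewrite !innerE (innerC y x) !inner_norm.
have xp : 0 < `|x| by rewrite normr_gt0.
have yp : 0 < `|y| by rewrite normr_gt0.
have xyp : 0 < `|x| * `|y| by apply: mulr_gt0.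
move=> h; rewrite -(ler_pM2l xyp); nra.
Qed.

Lemma inner_abs_le x y : `|inner x y| <= `|x| * `|y|.
Proof.
rewrite ler_norml inner_le_norm andbT.
by have := inner_le_norm (- x) y; rewrite innerNl normrN lerNl.
Qed.

Lemma inner_ext x y : (forall z, inner z x = inner z y) -> x = y.
Proof.
move=> h; apply/eqP; rewrite -subr_eq0; apply/eqP/inner_eq0.
by rewrite innerDr innerNr h subrr.
Qed.

Lemma inner_continuousl u : continuous (fun x => inner x u : R^o).
Proof.
apply: (@lipschitz_cont R X R^o _ `|u|) => x y.
by rewrite -innerNl -innerDl mulrC inner_abs_le.
Qed.

Lemma bounded_continuous {Y : hilbertType R} (A : {linear X -> Y}) :
  bounded_operator A -> continuous A.
Proof.
by move=> [c Ac]; apply: (@lipschitz_cont _ _ _ _ c) => x y; rewrite -linearB.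
Qed.

(* Points of almost minimal norm in the [Z n] form a Cauchy sequence by the
   parallelogram identity: the infima of the norms increase to a finite limit. *)
Lemma nested_convex_cvg (Z : nat -> set X) (c : R) :
  (forall n, Z n !=set0) ->
  (forall m n, (m <= n)%N -> Z n `<=` Z m) ->
  (forall n x y, Z n x -> Z n y -> Z n (2^-1 *: (x + y))) ->
  (forall x, Z 0%N x -> `|x| <= c) ->
  exists2 z : nat -> X, forall n, Z n (z n) & exists l : X, z @ \oo --> l.
Proof.
move=> Z0 Zdec Zmid Zb.
pose N n := [set inner x x | x in Z n].
have Nlb n : has_lbound (N n) by exists 0 => _ [x _ <-]; exact: inner_ge0.
have Ninf n : has_inf (N n).
  by split => //; have [x Zx] := Z0 n; exists (inner x x), x.
pose m n := inf (N n).
have mle n x : Z n x -> m n <= inner x x.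
  by move=> Zx; apply: ge_inf => //; exists x.
have mub n : m n <= c ^+ 2.
  have [x Zx] := Z0 n; apply: (le_trans (mle _ _ Zx)).
  have xc := Zb _ (Zdec 0%N n (leq0n n) x Zx).
  by rewrite inner_norm lerXn2r ?nnegrE// (le_trans _ xc).
have /choice[z zP] : forall n, exists x, Z n x /\ inner x x < m n + n.+1%:R^-1.
  move=> n; have n0 : 0 < n.+1%:R^-1 :> R by rewrite invr_gt0.
  by have [_ [x Zx <-] xm] := inf_adherent n0 (Ninf n); exists x.
exists z; first by move=> n; case: (zP n).
have msup : has_sup (range m).
  by split; [exists (m 0%N), 0%N|exists (c ^+ 2) => _ [n _ <-]].
apply/cvg_ex; apply: cauchy_cvg; apply: cauchy_exP => e e0.
(* The parallelogram identity bounds [|z n - z j|^2] by [2 (m j - m n) + 4 d], which is below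
   [6 d]. *)
pose d : R := e ^+ 2 / 8.
have d0 : 0 < d by rewrite divr_gt0// exprn_gt0.
have [_ [n0 _ <-] mn0] := sup_adherent d0 msup.
have mle_sup n : m n <= sup (range m).
  by apply: ub_le_sup; [case: msup|exists n].
have mmono i j : (i <= j)%N -> m i <= m j.
  move=> ij; apply: lb_le_inf; first by case: (Ninf j).
  by move=> _ [x Zx <-]; apply/mle/(Zdec i j).
have [n1 n1d] : exists n1 : nat, forall j, (n1 <= j)%N -> j.+1%:R^-1 < d.
  by have [n1 _ h] := near_infty_natSinv_lt (PosNum d0); exists n1.
pose n := maxn n0 n1.
exists (z n); exists n => // j /= nj.
rewrite -ball_normE /=.
have [Zn zn] := zP n; have [Zj zj] := zP j.
have h1 := mle _ _ (Zmid n _ _ Zn (Zdec _ _ nj _ Zj)).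
have {}zn : inner (z n) (z n) < m n + d.
  by apply: (lt_trans zn); rewrite ltrD2l n1d// leq_maxr.
have {}zj : inner (z j) (z j) < m j + d.
  by apply: (lt_trans zj); rewrite ltrD2l n1d// (leq_trans (leq_maxr _ _) nj).
have h4 := mmono n0 n (leq_maxl _ _).
have h5 := mle_sup j.
rewrite -(@ltr_pXn2r _ 2)// ?nnegrE// ?(ltW e0)// -inner_norm.
move: h1; rewrite !innerE !(innerC (z j) (z n)) => h1.
have -> : e ^+ 2 = 8 * d by rewrite /d; field.
lra.
Qed.

End InnerProduct.

Section LowerSemicontinuity.
Context {R : realType}.
Local Open Scope ereal_scope.

Lemma add_leE (u v : \bar R) (r : R) : -oo < u -> -oo < v -> u + v <= r%:E ->
  exists a b : R, [/\ u = a%:E, v = b%:E & (a + b <= r)%R].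
Proof.
case: u => [a| |]//; case: v => [b| |]// _ _; rewrite ?lee_fin => h.
by exists a, b.
Qed.

Lemma lt_ereal_between (a : R) (u : \bar R) : a%:E < u ->
  exists2 b : R, (a < b)%R & b%:E < u.
Proof.
case: u => [r| |]//; rewrite ?lte_fin => h.
  by exists ((a + r) / 2)%R; [lra|rewrite lte_fin; lra].
by exists (a + 1)%R; [lra|rewrite ltry].
Qed.

Lemma lsc_add {T : topologicalType} (f g : T -> \bar R) :
  (forall x, -oo < f x) -> (forall x, -oo < g x) ->
  lower_semicontinuous f -> lower_semicontinuous g ->
  lower_semicontinuous (fun x => f x + g x).
Proof.
move=> f0 g0 lf lg x a afg.
have [b [c [bf cg abc]]] : exists b c : R,
    [/\ b%:E < f x, c%:E < g x & (a < b + c)%R].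
  move: afg (f0 x) (g0 x); case: (f x) => [r| |]//; case: (g x) => [s| |]//.
  - rewrite lte_fin => h _ _; exists (r - (r + s - a) / 4)%R, (s - (r + s - a) / 4)%R.
    by split; rewrite ?lte_fin; lra.
  - by move=> _ _ _; exists (r - 1)%R, (a - r + 2)%R; split;
      rewrite ?ltry ?lte_fin//; lra.
  - by move=> _ _ _; exists (a - s + 2)%R, (s - 1)%R; split;
      rewrite ?ltry ?lte_fin//; lra.
  - by move=> _ _ _; exists (a + 1)%R, 0%R; split; rewrite ?ltry//; lra.
have [V Vx Vf] := lf x b bf; have [W Wx Wg] := lg x c cg.
exists (V `&` W); first exact: filterI.
move=> y [/Vf bfy /Wg cgy]; apply: (@lt_trans _ _ (b + c)%:E); first by rewrite lte_fin.
by rewrite EFinD lteD.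
Qed.

Lemma lsc_comp {T U : topologicalType} (f : U -> \bar R) (A : T -> U) :
  continuous A -> lower_semicontinuous f -> lower_semicontinuous (fun x => f (A x)).
Proof.
move=> cA lf x a /lf[V Vx Vf]; exists (A @^-1` V); first exact: cA.
by move=> y /Vf.
Qed.

Lemma lsc_cont {T : topologicalType} (f : T -> R) :
  continuous f -> lower_semicontinuous (fun x => (f x)%:E).
Proof.
move=> cf x a; rewrite lte_fin => afx; exists [set y | (a < f y)%R] => //.
have := cvgr_gt _ (cf x) _ afx; exact.
Qed.

Lemma lsc_le_lim {T : topologicalType} (f : T -> \bar R) (z : nat -> T) l (a : R) :
  lower_semicontinuous f -> z @ \oo --> l ->
  (forall e : R, (0 < e)%R -> \forall n \near \oo, f (z n) <= (a + e)%:E) ->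
  f l <= a%:E.
Proof.
move=> lf zl h; rewrite leNgt; apply/negP => afl.
have [b ab bfl] := lt_ereal_between afl.
have [V Vl Vf] := lf l b bfl.
have ba : (0 < b - a)%R by rewrite subr_gt0.
have [n [/= h1 /Vf]] := filter_ex (filterI (h _ ba) (zl V Vl)).
rewrite addrC subrK in h1.
by rewrite ltNge h1.
Qed.

End LowerSemicontinuity.

(** * Proximity operators *)

(** Let [t] tend to 0; only [t] in []0,1[] is available when [t] is a convexity coefficient. *)
Lemma le_of_le_add_scaled {R : realType} (a b c : R) :
  (forall t, 0 < t < 1 -> a <= b + t * c) -> a <= b.
Proof.
move=> h; apply/ler_addgt0Pr => e e0.
have [c0|c0] := leP c 0; first by have := h (2^-1) ltac:(lra); nra.
pose t := Num.min (2^-1) (e / c).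
have t0 : 0 < t by rewrite lt_min divr_gt0// andbT; lra.
have t1 : t < 1 by rewrite gt_min; apply/orP; left; lra.
have te : t * c <= e by rewrite -ler_pdivlMr// ge_min lexx orbT.
by have := h t; rewrite t0 t1 => /(_ isT); lra.
Qed.

(** Real upper bounds admit the endpoints of [[0,1]] and spare later proofs any product with an
    infinite value. *)
Lemma convex_le {R : realType} {X : hilbertType R} (f : X -> \bar R)
    (x y : X) (t a b : R) :
  Gamma0 f -> 0 <= t <= 1 -> (f x <= a%:E)%E -> (f y <= b%:E)%E ->
  (f (t *: x + (1 - t) *: y)%R <= (t * a + (1 - t) * b)%:E)%E.
Proof.
move=> [f0 _ fc _] /andP[t0 t1] fx fy.
move: t0; rewrite le_eqVlt => /predU1P[<-|t0].
  by rewrite !subr0 scale0r add0r scale1r mul0r add0r mul1r.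
move: t1; rewrite le_eqVlt => /predU1P[->|t1].
  by rewrite !subrr scale0r addr0 scale1r mul0r addr0 mul1r.
apply: (le_trans (fc x y t _)); first by rewrite t0 t1.
by rewrite [leRHS]EFinD (EFinM t) (EFinM (1 - t)) leeD// lee_pmul2l// lte_fin subr_gt0.
Qed.

Section Prox.
Context {R : realType} {X : hilbertType R}.
Implicit Types (f : X -> \bar R) (x y z p u : X).

(** With [r = f x0] finite, [f] exceeds [r - 1] on a ball of radius [d] around [x0]. Convexity on
    the segment from [x0] to a farther [y] then limits the decrease to slope [2 / d]. *)
Lemma Gamma0_minorant f : Gamma0 f ->
  exists x0 (a b : R), 0 <= b /\ forall y, ((a - b * `|y - x0|)%:E <= f y)%E.
Proof.
move=> Gf; have [f0 flsc _ [x0 domx0]] := Gf.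
have fx0 := f0 x0.
move: domx0; rewrite /dom /=; case E : (f x0) fx0 => [r| |]// _ _.
have [V Vx0 Vf] : exists2 V, nbhs x0 V & forall y, V y -> ((r - 1)%:E < f y)%E.
  by apply: flsc; rewrite E lte_fin; lra.
move: Vx0 => /nbhs_ballP[d /= d0 dV].
exists x0, (r - 1), (2 / d); split; first by rewrite divr_ge0// ltW.
move=> y; have [yd|dy] := ltP (`|y - x0|) d.
  have /dV/Vf/ltW : ball x0 d y by rewrite -ball_normE /= distrC.
  apply: le_trans; rewrite lee_fin.
  by rewrite lerBlDr lerDl mulr_ge0// divr_ge0// ltW.
have y0 : 0 < `|y - x0| by apply: lt_le_trans dy.
have fy0 := f0 y; case Ey : (f y) fy0 => [s| |]// _; last by rewrite leey.
(* This weight places the convex combination at distance [d / 2] from [x0], inside the ball. *)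
pose t := d / 2 / `|y - x0|.
have t0 : 0 < t by rewrite !divr_gt0.
have t1 : t <= 1 by rewrite ler_pdivrMr//; lra.
have : ball x0 d (t *: y + (1 - t) *: x0).
  rewrite -ball_normE /= scalerBl scale1r addrCA opprD addNKr -scalerBr normrN.
  by rewrite normrZ gtr0_norm// /t divfK ?gt_eqF//; lra.
move=> /dV/Vf h.
have := @convex_le _ _ f y x0 t s r Gf; rewrite Ey E !lexx t1 (ltW t0).
move=> /(_ isT isT isT)/(lt_le_trans h); rewrite lte_fin lee_fin => {}h.
have ty : 2 / d * `|y - x0| = t^-1.
  by rewrite /t; field; rewrite !gt_eqF.
rewrite ty lerBlDr -(ler_pM2l t0) !mulrDr mulfV ?gt_eqF//; nra.
Qed.

Lemma continuous_sqnorm_sub x : continuous (fun y => `|x - y| ^+ 2 / 2).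
Proof.
move=> y; apply: cvgMl; apply: cvgM; apply: cvg_norm;
  by apply: cvgB; [exact: cvg_cst|exact: cvg_id].
Qed.

Definition prox_min f x p :=
  forall z, (f p + half_sq (x - p)%R <= f z + half_sq (x - z)%R)%E.

(** The quadratic term dominates the minorant, so near-minimizers are bounded. Their sets are nested
    and stable under midpoints, hence [nested_convex_cvg] gives a convergent minimizing sequence,
    and lower semicontinuity concludes. *)
Lemma prox_min_exists f x : Gamma0 f -> exists p, prox_min f x p.
Proof.
move=> Gf; have [f0 flsc _ [y0 domy0]] := Gf.
have [x0 [a [b [b0 fab]]]] := Gamma0_minorant Gf.
pose phi y := (f y + half_sq (x - y)%R)%E.
have phi_lsc : lower_semicontinuous phi.
  apply: lsc_add => // [y|]; first exact: ltNyr.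
  exact: (lsc_cont (@continuous_sqnorm_sub x)).
pose c := `|x - x0|.
have phi_lb y (r : R) : (phi y <= r%:E)%E ->
    a - b * c - b * `|x - y| + `|x - y| ^+ 2 / 2 <= r.
  move=> h; have [s [q [Es [Eq]]]] := add_leE (f0 y) (ltNyr _) h.
  have := fab y; rewrite Es lee_fin => ys; subst q.
  apply: le_trans; rewrite lerD2r; apply: (le_trans _ ys).
  have : `|y - x0| <= `|x - y| + c.
    by rewrite /c -(distrC y) (le_trans _ (ler_normD _ _))// addrA subrK.
  by move=> /(ler_wpM2l b0); lra.
pose A := [set r : R | exists y, (phi y <= r%:E)%E].
have Ainf : has_inf A.
  split; last first.
    exists (a - b * c - b ^+ 2 / 2) => r [y /phi_lb]; apply: le_trans.
    by have := sqr_ge0 (`|x - y| - b); rewrite sqrrB; lra.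
  have := f0 y0; move: domy0; rewrite /dom /=; case E : (f y0) => [r| |]// _ _.
  by exists (r + `|x - y0| ^+ 2 / 2), y0; rewrite /phi E.
pose m := inf A.
have mle y r : (phi y <= r%:E)%E -> m <= r.
  by move=> h; apply: ge_inf; [case: Ainf|exists y].
pose Z n := [set y | (phi y <= (m + n.+1%:R^-1)%:E)%E].
(* The radius comes from [s^2 <= 2 b s + |d|] with [s = |x - y|] and [d = 2 (m + 1 - a + b c)],
   which forces [s <= 2 b + |d| + 1]. *)
have [||||z Zz [l zl]] := @nested_convex_cvg R X Z
    (`|x| + (2 * b + `|2 * (m + 1 - a + b * c)| + 1)).
- move=> n; have n0 : 0 < n.+1%:R^-1 :> R by rewrite invr_gt0.
  have [r [y yr] rm] := inf_adherent n0 Ainf.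
  by exists y; rewrite /Z /= (le_trans yr)// lee_fin ltW.
- move=> i j ij y; rewrite /Z /= => /le_trans; apply.
  by rewrite lee_fin lerD2l lef_pV2 ?posrE// ler_nat.
- move=> n y z; rewrite /Z /= => hy hz.
  have [r [q [Er [Eq hrq]]]] := add_leE (f0 y) (ltNyr _) hy.
  have [s [q' [Es [Eq' hsq]]]] := add_leE (f0 z) (ltNyr _) hz.
  subst q q'.
  have -> : 2^-1 *: (y + z) = 2^-1 *: y + (1 - 2^-1) *: z.
    by rewrite scalerDr; congr (_ + _ *: _); field.
  have := @convex_le _ _ f y z 2^-1 r s Gf; rewrite Er Es !lexx.
  have h12 : 0 <= (2^-1 : R) <= 1 by lra.
  move=> /(_ h12 isT isT); set w := (_ *: y + _)%R => hw.
  rewrite /phi (le_trans (leeD2r _ hw))// lee_fin.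
  have : `|x - w| ^+ 2 <= (`|x - y| ^+ 2 + `|x - z| ^+ 2) / 2.
    have := inner_ge0 (y - z).
    rewrite -!inner_norm /w !innerE !(innerC y x) !(innerC z x) !(innerC z y).
    by lra.
  by move: n.+1%:R^-1 hrq hsq {hy hz} => q; lra.
- move=> y; rewrite /Z /= => /phi_lb.
  rewrite invr1; set s := `|x - y|; set d := 2 * (m + 1 - a + b * c) => h.
  have s0 : 0 <= s by exact: normr_ge0.
  have hs : s ^+ 2 <= 2 * b * s + `|d|.
    have := ler_norm d; rewrite {1}/d; lra.
  have d0 := normr_ge0 d.
  have sle : s <= 2 * b + `|d| + 1.
    rewrite leNgt; apply/negP => hlt.
    have : (2 * b + `|d| + 1) * s < s * s by rewrite ltr_pM2r; lra.
    nra.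
  have : `|y| <= `|x| + s.
    by have := ler_normB x (x - y); rewrite subKr.
  lra.
exists l => y; change (phi l <= phi y)%E.
have phil : (phi l <= m%:E)%E.
  apply: (lsc_le_lim phi_lsc zl) => e e0.
  have [n1 _ h] := near_infty_natSinv_lt (PosNum e0).
  exists n1 => // n /= n1n; apply: (le_trans (Zz n)).
  by rewrite lee_fin lerD2l ltW// h.
apply: (le_trans phil).
have [E|] := eqVneq (phi y) +oo%E; first by rewrite E leey.
have : (-oo < phi y)%E.
  by rewrite /phi /half_sq; case: (f y) (f0 y) => [r| |]//= _; rewrite ltNyr.
by case E : (phi y) => [r| |]// _ _; rewrite lee_fin (mle y)// E.
Qed.

(** Minimality is tested on the segment from [p] to [z]; dividing by [t] and letting it tend to 0
    leaves the subgradient inequality. *)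
Lemma prox_min_subdiff f x p : Gamma0 f -> prox_min f x p -> subdiff f p (x - p).
Proof.
move=> Gf pmin z; have [f0 _ _ [y0 domy0]] := Gf.
have [r Er] : exists r : R, f p = r%:E.
  have := pmin y0; have := f0 y0; have := f0 p; move: domy0; rewrite /dom /=.
  by case: (f y0) => [s| |]//; case: (f p) => [r| |]//; exists r.
have := f0 z; case Ez : (f z) => [s| |]// _; last by rewrite leey.
rewrite Er lee_fin; apply: le_of_le_add_scaled => t /andP[t0 t1].
have := @convex_le _ _ f z p t s r Gf; rewrite Ez Er !lexx (ltW t0) (ltW t1).
move=> /(_ isT isT isT) h.
have := le_trans (pmin _) (leeD2r _ h).
instantiate (1 := `|z - p| ^+ 2 / 2).
rewrite Er lee_fin -!inner_norm !innerE.
rewrite !(innerC p x) !(innerC z x) !(innerC z p) => {}h.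
rewrite -(ler_pM2l t0); nra.
Qed.

(** The surplus [half_sq (z - p)] comes from the strong convexity of the quadratic and gives
    uniqueness of the minimizer in [proxP]. *)
Lemma subdiff_prox_min f x p z (r : R) : Gamma0 f -> f p = r%:E ->
  subdiff f p (x - p) ->
  (f p + half_sq (x - p)%R + half_sq (z - p)%R <= f z + half_sq (x - z)%R)%E.
Proof.
move=> [f0 _ _ _] Er sub; have := sub z; have := f0 z.
rewrite Er /half_sq; case: (f z) => [s| |]//= _; last by move=> _; rewrite addye// leey.
rewrite !lee_fin -!inner_norm !innerE.
rewrite !(innerC p x) !(innerC z x) !(innerC z p); lra.
Qed.

Lemma subdiff_fin f p u : Gamma0 f -> subdiff f p u -> exists r : R, f p = r%:E.
Proof.
move=> [f0 _ _ [y0 domy0]] sub.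
have := sub y0; have := f0 y0; have := f0 p; move: domy0; rewrite /dom /=.
by case: (f y0) => [s| |]//; case: (f p) => [r| |]//; exists r.
Qed.

Lemma proxP f x p : Gamma0 f -> prox f x = p <-> subdiff f p (x - p).
Proof.
move=> Gf; split => [<-|sub].
  apply: prox_min_subdiff => //; rewrite /prox.
  exact: (getPex (prox_min_exists x Gf)).
have [r Er] := subdiff_fin Gf sub.
rewrite /prox; apply: get_unique.
  move=> z; apply: (le_trans _ (@subdiff_prox_min f x p z r Gf Er sub)).
  by rewrite Er /half_sq -!EFinD lee_fin lerDl divr_ge0// exprn_ge0.
move=> q qmin; have := le_trans (@subdiff_prox_min f x p q r Gf Er sub) (qmin p).
rewrite Er /half_sq -!EFinD lee_fin => h.
have : `|q - p| ^+ 2 <= 0 by lra.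
by rewrite -inner_norm => h2; apply/subr0_eq/inner_eq0/eqP; rewrite eq_le h2 inner_ge0.
Qed.

Lemma subdiff_prox f x : Gamma0 f -> subdiff f (prox f x) (x - prox f x).
Proof. by move=> Gf; apply/proxP. Qed.

Lemma Gamma0_real (F : X -> R) : continuous F ->
  (forall x y t, 0 < t < 1 ->
     F (t *: x + (1 - t) *: y) <= t * F x + (1 - t) * F y) ->
  Gamma0 (fun x => (F x)%:E).
Proof.
move=> cF convF; split => [x||x y t t01|]; first exact: ltNyr.
- exact: lsc_cont.
- by rewrite -!EFinM -EFinD lee_fin convF.
- by exists 0; rewrite /dom /= ltry.
Qed.

(* The prox of a sublinear function maps 0 to the opposite of a subgradient
   at 0, because subgradients of sublinear functions are subgradients at 0. *)
Lemma sublinear_subgradient (P : X -> R) : continuous P ->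
  (forall x y, P (x + y) <= P x + P y) ->
  (forall t x, 0 < t -> P (t *: x) = t * P x) ->
  exists v, forall d, inner d v <= P d.
Proof.
move=> cP Padd Phom.
have GP : Gamma0 (fun x => (P x)%:E).
  apply: Gamma0_real => // x y t /andP[t0 t1].
  by rewrite (le_trans (Padd _ _))// !Phom// subr_gt0.
set p := prox (fun x => (P x)%:E) 0; exists (- p) => d.
have sub := subdiff_prox 0 GP; rewrite -/p sub0r in sub.
have {}sub z : inner (z - p) (- p) + P p <= P z by have := sub z; rewrite lee_fin.
(* The subgradient inequality at [t^-1 *: d], multiplied by [t], differs from the goal by a term of
   order [t]. *)
apply: (@le_of_le_add_scaled _ _ _ (- (P p - inner p (- p)))) => t /andP[t0 t1].
have := sub (t^-1 *: d); rewrite Phom ?invr_gt0// innerDl innerNl innerZl.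
move=> /(ler_wpM2l (ltW t0)); rewrite !mulrDr !mulVKf ?gt_eqF//.
nra.
Qed.

End Prox.

(** * Adjoints, projections and conjugates *)

Section Adjoint.
Context {R : realType} {X Y : hilbertType R}.

(** A subgradient of a linear function bounds it below; the same bound at [- z] makes it an
    equality. *)
Lemma riesz (l : X -> R) : continuous l ->
  (forall x y, l (x + y) = l x + l y) -> (forall a x, l (a *: x) = a * l x) ->
  exists v, forall z, l z = inner z v.
Proof.
move=> cl ladd lscale.
have [||v vle] := sublinear_subgradient cl.
- by move=> x y; rewrite ladd.
- by move=> t x _; exact: lscale.
exists v => z; apply/eqP; rewrite eq_le vle andbT.
have := vle (- z); rewrite innerNl lerNl; apply: le_trans.
by rewrite -(scaleN1r z) lscale mulN1r opprK.
Qed.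

Lemma adjointP (M : {linear X -> Y}) z y : bounded_operator M ->
  inner (M z) y = inner z (adjoint M y).
Proof.
move=> Mb; have [|||v vP] := @riesz (fun z => inner (M z) y).
- move=> x; apply: (@continuous_comp _ _ _ M (fun z => inner z y : R^o)).
    exact: bounded_continuous.
  exact: inner_continuousl.
- by move=> a b; rewrite linearD innerDl.
- by move=> a b; rewrite linearZ innerZl.
by rewrite /adjoint; apply: (getPex (P := [set x | forall z, _ = inner z x])); exists v.
Qed.

Variables (A : X -> Y) (B : Y -> X).
Hypothesis adjAB : forall x y, inner (A x) y = inner x (B y).

(** The adjoint relation alone forces linearity; this covers [adjoint M], which is a plain
    function. *)
Lemma adj_add x y : A (x + y) = A x + A y.
Proof. by apply: inner_ext => z; rewrite innerC adjAB !innerE !(innerC z) !adjAB. Qed.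

Lemma adj_scale a x : A (a *: x) = a *: A x.
Proof. by apply: inner_ext => z; rewrite innerC adjAB !innerE !(innerC z) !adjAB. Qed.

End Adjoint.

(** For a difference [d], [|B d|^2 = <d | A (B d)> <= |c| |d| |B d|]. *)
Lemma adj_continuous {R : realType} {X Y : hilbertType R} (A : X -> Y)
    (B : Y -> X) (c : R) :
  (forall x y, inner (A x) y = inner x (B y)) ->
  (forall x, `|A x| <= c * `|x|) -> continuous B.
Proof.
move=> adjAB Ac.
have adjBA y x : inner (B y) x = inner y (A x) by rewrite innerC -adjAB innerC.
apply: (@lipschitz_cont _ _ _ _ `|c|) => x y.
rewrite -scaleN1r -(adj_scale adjBA) -(adj_add adjBA) scaleN1r.
set d := x - y.
have [->|Bd0] := eqVneq (B d) 0; first by rewrite normr0 mulr_ge0.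
have Bd : 0 < `|B d| by rewrite normr_gt0.
rewrite -(ler_pM2r Bd) -expr2 -inner_norm adjBA.
apply: (le_trans (inner_le_norm _ _)); rewrite mulrAC mulrC ler_wpM2r//.
by rewrite (le_trans (Ac _))// ler_wpM2r// ler_norm.
Qed.

(** [P] is the prox of the indicator function of [S]. Compatibility with translations along [S]
    stands in for linearity in the Baire argument below. *)
Lemma projection_exists {R : realType} {X : hilbertType R} (S : set X) :
  closed S -> S 0 -> (forall a u v, S u -> S v -> S (a *: u + v)) ->
  exists P : X -> X, [/\ continuous P, forall x, S (P x) &
    forall x d, S d -> P (x + d) = P x + d].
Proof.
move=> Scl S0 Slin.
have SD u v : S u -> S v -> S (u + v).
  by move=> Su Sv; rewrite -(scale1r u); exact: Slin.
have SB u v : S u -> S v -> S (u - v).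
  by move=> Su Sv; rewrite addrC -scaleN1r; exact: Slin.
pose i x : \bar R := if `[< S x >] then 0%E else +oo%E.
have iS x : S x -> i x = 0%E by rewrite /i => /asboolT ->.
have iE x (r : R) : (i x <= r%:E)%E -> S x.
  by rewrite /i; case: asboolP.
have Gi : Gamma0 i.
  split => [x|x a||]; first by rewrite /i; case: ifP => _; rewrite ?ltNyr ?ltNy0.
  - have [Sx|nSx] := pselect (S x).
      rewrite iS// lte_fin => a0; exists setT; first exact: filterT.
      by move=> y _; rewrite /i; case: ifP; rewrite ?ltry ?lte_fin.
    move=> _; exists (~` S); first by apply: open_nbhs_nbhs; split; rewrite ?openC.
    by move=> y Sy; rewrite /i asboolF// ltry.
  - move=> x y t /andP[t0 t1].
    rewrite {2 3}/i; case: asboolP => Sx; last first.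
      by rewrite gt0_muley ?lte_fin// addye ?leey//; case: asboolP;
        rewrite ?mule0// gt0_muley// lte_fin subr_gt0.
    case: asboolP => Sy; last first.
      by rewrite mule0 add0e gt0_muley ?leey// lte_fin subr_gt0.
    rewrite !mule0 adde0 iS//; apply: (Slin) => //.
    by rewrite -[_ *: y]addr0; apply: Slin.
  - by exists 0; rewrite /dom /= iS// ltry.
have PS x : S (prox i x).
  by have [r ir] := subdiff_fin Gi (subdiff_prox x Gi); apply: (iE _ r); rewrite ir.
have Pvar x s : S s -> inner (s - prox i x) (x - prox i x) <= 0.
  by move=> Ss; have := subdiff_prox x Gi s; rewrite !iS// adde0 lee_fin.
exists (prox i); split => // [|x d Sd].
  (* Adding the variational inequalities at [x] and [y] shows nonexpansiveness. *)
  apply: (@lipschitz_cont _ _ _ _ 1) => x y; rewrite mul1r.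
  have := Pvar x _ (PS y); have := Pvar y _ (PS x).
  set p := prox i x; set q := prox i y => hx hy.
  have h : `|p - q| ^+ 2 <= `|x - y| * `|p - q|.
    apply: le_trans (inner_le_norm _ _); move: hx hy.
    rewrite -inner_norm !innerE !(innerC q p) !(innerC p x) !(innerC p y).
    by rewrite !(innerC q x) !(innerC q y); lra.
  have [->|pq0] := eqVneq (p - q) 0; first by rewrite normr0.
  by rewrite -(@ler_pM2r _ `|p - q|) ?normr_gt0// -expr2.
apply/proxP => //.
rewrite opprD addrACA subrr addr0 => z; rewrite iS; last exact: SD.
rewrite adde0; have [Sz|nSz] := pselect (S z); last by rewrite /i asboolF ?leey.
by rewrite iS// lee_fin opprD addrA addrAC; apply/Pvar/SB.
Qed.

Section Conjugate.
Context {R : realType} {X : hilbertType R}.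
Implicit Types f g : X -> \bar R.

Lemma convex_of_real f :
  (forall x y t (a b : R), 0 < t < 1 -> f x = a%:E -> f y = b%:E ->
     (f (t *: x + (1 - t) *: y)%R <= (t * a + (1 - t) * b)%:E)%E) ->
  (forall x, (-oo < f x)%E) ->
  forall (x y : X) (t : R), 0 < t < 1 ->
    (f (t *: x + (1 - t) *: y)%R <= t%:E * f x + (1 - t)%:E * f y)%E.
Proof.
move=> fc f0 x y t t01; have /andP[t0 t1] := t01.
have := f0 x; case Ex : (f x) => [a| |]// _; last first.
  rewrite gt0_muley// addye ?leey//; have := f0 y.
  by case: (f y) => [b| |]//= _; rewrite gt0_muley// lte_fin subr_gt0.
have := f0 y; case Ey : (f y) => [b| |]// _; last first.
  by rewrite gt0_muley ?addey ?leey// lte_fin subr_gt0.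
by rewrite -!EFinM -EFinD; exact: fc.
Qed.

(* The hypothesis says that [f] is the supremum of the affine functions
   [u |-> <p.1 | u> + p.2] for [p] in [E]. *)
Lemma Gamma0_affine_sup (E : set (X * R)) f :
  (forall u (a : R), (f u <= a%:E)%E <->
     forall p, E p -> inner p.1 u + p.2 <= a) ->
  E !=set0 -> dom f !=set0 -> Gamma0 f.
Proof.
move=> fE [p0 Ep0] fdom.
have f0 x : (-oo < f x)%E.
  have h (a : R) : (f x <= a%:E)%E -> inner p0.1 x + p0.2 <= a by move=> /fE; apply.
  case E1 : (f x) h => [r| |]//= h; first exact: ltNyr.
  have := h (inner p0.1 x + p0.2 - 1).
  by rewrite leNye => /(_ isT); rewrite lerBrDr gerDl ler10.
split => //; last first.
  apply: convex_of_real => // x y t a b /andP[t0 t1] fx fy; apply/fE => p Ep.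
  have : inner p.1 x + p.2 <= a by apply: (fE x a).1; rewrite ?fx.
  have : inner p.1 y + p.2 <= b by apply: (fE y b).1; rewrite ?fy.
  by rewrite !innerE; nra.
move=> x a afx.
have [p [Ep ap]] : exists p, E p /\ a < inner p.1 x + p.2.
  apply: contrapT => h; move: afx; rewrite ltNge => /negP; apply.
  by apply/fE => p Ep; rewrite leNgt; apply/negP => ?; apply: h; exists p.
exists [set y | a < inner y p.1 + p.2].
  have /cvgr_gt : inner y p.1 + p.2 @[y --> x] --> inner x p.1 + p.2.
    by apply: cvgD; [exact: inner_continuousl|exact: cvg_cst].
  by apply; rewrite innerC.
move=> y /= ay; rewrite ltNge; apply/negP => /fE/(_ p Ep).
by rewrite innerC; lra.
Qed.

Lemma conjugate_le f (u : X) (a : R) : (forall x, (-oo < f x)%E) ->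
  (conjugate f u <= a%:E)%E <->
  forall x (r : R), f x = r%:E -> inner x u - r <= a.
Proof.
move=> f0; split => [h x r fx|h].
  rewrite -lee_fin; apply: le_trans h; apply: ereal_sup_ubound.
  by exists x => //; rewrite fx.
apply: ge_ereal_sup => _ [x _ <-].
have := f0 x; case E : (f x) => [r| |]// _; last by rewrite leNye.
by rewrite -EFinB lee_fin; exact: h.
Qed.

Lemma conjugate_ge f (x u : X) (r : R) :
  f x = r%:E -> ((inner x u - r)%:E <= conjugate f u)%E.
Proof. by move=> fx; apply: ereal_sup_ubound; exists x => //; rewrite fx. Qed.

(** Equality case of Fenchel-Young: the subgradient inequality says that [x] attains the
    supremum. *)
Lemma conjugate_subdiff f (x u : X) (r : R) : (forall x, (-oo < f x)%E) ->
  f x = r%:E -> subdiff f x u -> conjugate f u = (inner x u - r)%:E.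
Proof.
move=> f0 fx sub; apply/eqP; rewrite eq_le conjugate_ge// andbT.
apply/conjugate_le => // y s fy; have := sub y; rewrite fx fy lee_fin !innerE; lra.
Qed.

(** The conjugate is a supremum of affine functions indexed by the graph of [f]. It is finite at any
    subgradient, and [prox f 0] provides one. *)
Lemma Gamma0_conjugate f : Gamma0 f -> Gamma0 (conjugate f).
Proof.
move=> Gf; have [f0 _ _ _] := Gf.
have sub := subdiff_prox 0 Gf.
have [r fr] := subdiff_fin Gf sub.
apply: (@Gamma0_affine_sup [set p | f p.1 = (- p.2)%:E]).
- move=> u a; split => [/(conjugate_le _ _ f0) h p /= fp|h].
    by have := h _ _ fp; rewrite opprK.
  apply/conjugate_le => // x s fx; apply: (h (x, - s)).
  by rewrite /= opprK.
- by exists (prox f 0, - r); rewrite /= opprK.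
- by exists (0 - prox f 0); rewrite /dom /= (conjugate_subdiff f0 fr sub) ltry.
Qed.

Lemma subdiff_monotone f x y u v : Gamma0 f ->
  subdiff f x u -> subdiff f y v -> 0 <= inner (x - y) (u - v).
Proof.
move=> Gf su sv; have [r fx] := subdiff_fin Gf su; have [s fy] := subdiff_fin Gf sv.
have := su y; have := sv x; rewrite fx fy !lee_fin !innerE; lra.
Qed.

Lemma subdiff_conjugate_sub f x u : Gamma0 f ->
  subdiff f x u -> subdiff (conjugate f) u x.
Proof.
move=> Gf sub v; have [r fx] := subdiff_fin Gf sub; have [f0 _ _ _] := Gf.
rewrite (conjugate_subdiff f0 fx sub) (le_trans _ (conjugate_ge v fx))//.
by rewrite -EFinD lee_fin !innerE !(innerC x); lra.
Qed.

(* [p = prox f (x + u)] also satisfies [subdiff (conjugate f) (x + u - p) p],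
   and monotonicity then forces [p = x]. *)
Lemma subdiff_conjugate f x u : Gamma0 f ->
  subdiff f x u <-> subdiff (conjugate f) u x.
Proof.
move=> Gf; split; first exact: subdiff_conjugate_sub.
move=> subc; have sub := subdiff_prox (x + u) Gf.
set p := prox f (x + u) in sub.
have := subdiff_monotone (Gamma0_conjugate Gf) subc (subdiff_conjugate_sub Gf sub).
have -> : u - (x + u - p) = - (x - p).
  by rewrite !opprD opprK !addrA (addrAC u) subrr add0r.
rewrite innerNl oppr_ge0 => h.
have /subr0_eq xp : x - p = 0 by apply/inner_eq0/eqP; rewrite eq_le h inner_ge0.
by move: sub; rewrite -xp addrAC subrr add0r.
Qed.

Lemma dom_add f g : (forall x, -oo < f x)%E -> (forall x, -oo < g x)%E ->
  dom (fun x => f x + g x)%E = dom f `&` dom g.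
Proof.
move=> f0 g0; apply/seteqP; split => x; rewrite /dom /setI /=;
  have := f0 x; have := g0 x; case: (f x) => [a| |]//; case: (g x) => [b| |]// _ _;
  by rewrite -?EFinD ?addye ?addey ?ltry ?ltxx//; case.
Qed.

Lemma Gamma0_add f g : Gamma0 f -> Gamma0 g -> dom f `&` dom g !=set0 ->
  Gamma0 (fun x => f x + g x)%E.
Proof.
move=> Gf Gg fg; have [f0 lf _ _] := Gf; have [g0 lg _ _] := Gg.
have fg0 x : (-oo < f x + g x)%E.
  by have := f0 x; have := g0 x; case: (f x) => [a| |]//; case: (g x) => [b| |]// _ _;
    rewrite -?EFinD ?addye ?addey ?ltNyr.
split => //; [exact: lsc_add| |by rewrite dom_add].
apply: convex_of_real => // x y t a b /andP[t0 t1] fgx fgy.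
have ha : (f x + g x <= a%:E)%E by rewrite fgx.
have hb : (f y + g y <= b%:E)%E by rewrite fgy.
have [c [d [fx gx cd]]] := add_leE (f0 x) (g0 x) ha.
have [c' [d' [fy gy cd']]] := add_leE (f0 y) (g0 y) hb.
have t01 : 0 <= t <= 1 by rewrite !ltW.
have h1 := @convex_le _ _ f x y t c c' Gf t01.
have h2 := @convex_le _ _ g x y t d d' Gg t01.
rewrite fx fy gx gy !lexx in h1 h2.
by rewrite (le_trans (leeD (h1 isT isT) (h2 isT isT)))// -EFinD lee_fin; nra.
Qed.

Lemma Gamma0_comp {Y : hilbertType R} (A : X -> Y) (k : Y -> \bar R) :
  Gamma0 k -> continuous A -> (forall x y, A (x + y) = A x + A y) ->
  (forall a x, A (a *: x) = a *: A x) -> (exists x, dom k (A x)) ->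
  Gamma0 (fun x => k (A x)).
Proof.
move=> [k0 lk ck _] cA AD AZ [x domx].
split => //; [exact: lsc_comp| |by exists x].
by move=> y z t t01; rewrite AD !AZ; exact: ck.
Qed.

End Conjugate.

(** * Subgradients of perturbation functions *)

(* [E z w r] reads [Phi z w <= r] for a closed convex perturbation function
   [Phi]; [mu] is the minimum of [Phi _ 0], attained at [x]. *)
Section ValueFunction.
Context {R : realType} {X Y : hilbertType R} (E : X -> Y -> R -> Prop).
Context (x : X) (mu : R) (S : set Y).
Context (Econv : forall z z' w w' r r' t, 0 <= t <= 1 -> E z w r -> E z' w' r' ->
  E (t *: z + (1 - t) *: z') (t *: w + (1 - t) *: w') (t * r + (1 - t) * r')).
Context (Eup : forall z w r r', r <= r' -> E z w r -> E z w r').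
Context (Ecl : forall (z : nat -> X) (w : nat -> Y) l l' r,
  z @ \oo --> l -> w @ \oo --> l' -> (forall n, E (z n) (w n) r) -> E l l' r).
Context (Ex : E x 0 mu) (Emin : forall z r, E z 0 r -> mu <= r).
(** By [ES] and [SE], [S] is the cone generated by the domain of the value function; the strong
    relative interior condition makes it a closed subspace. *)
Context (Scl : closed S) (S0 : S 0).
Context (Slin : forall a u v, S u -> S v -> S (a *: u + v)).
Context (ES : forall z w r, E z w r -> S w).
Context (SE : forall w, S w -> exists t z r, 0 < t /\ E z (t *: w) r).

(** Bounding both the witness and the value makes these convex sets closed, while their union is
    still the whole domain of the value function. *)
Let C (n : nat) := [set w | exists z, `|z| <= n%:R /\ E z w n%:R].

Let normr_conv_le {V : normedModType R} (u v : V) (t b : R) : 0 <= t <= 1 ->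
  `|u| <= b -> `|v| <= b -> `|t *: u + (1 - t) *: v| <= b.
Proof.
move=> /andP[t0 t1] ub vb; rewrite (le_trans (ler_normD _ _))// !normrZ.
by rewrite !ger0_norm ?subr_ge0//; nra.
Qed.

Let C_conv n w w' t : 0 <= t <= 1 -> C n w -> C n w' ->
  C n (t *: w + (1 - t) *: w').
Proof.
move=> t01 [z [zn Ez]] [z' [zn' Ez']]; exists (t *: z + (1 - t) *: z').
split; first exact: normr_conv_le.
by have := Econv t01 Ez Ez'; rewrite -mulrDl (addrC t) subrK mul1r.
Qed.

Let C_mono n m : (n <= m)%N -> C n `<=` C m.
Proof.
move=> nm w [z [zn Ez]]; have nmR : n%:R <= m%:R :> R by rewrite ler_nat.
by exists z; split; [exact: le_trans nmR|exact: Eup Ez].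
Qed.

Let C_mem z w r : E z w r -> exists n, C n w.
Proof.
move=> Ez; exists (Num.truncn (`|z| + `|r|)).+1, z.
have h := ltW (truncnS_gt (`|z| + `|r|)).
split; first by rewrite (le_trans _ h)// lerDl.
by apply: Eup Ez; rewrite (le_trans _ h)// (le_trans (ler_norm _))// lerDr.
Qed.

(** Witnesses for points tending to [w] are only bounded. Those for points within [1 / (k + 1)] of
    [w] form nested sets stable under midpoints, from which [nested_convex_cvg] selects a convergent
    sequence. *)
Let C_closed n : closed (C n).
Proof.
rewrite closedE => w wC.
have near_w (e : R) : 0 < e -> exists2 w', C n w' & `|w - w'| <= e.
  move=> e0; apply: contrapT => h; apply: wC; apply/nbhs_ballP; exists e => //.
  move=> w'; rewrite -ball_normE /= => ww' Cw'; apply: h.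
  by exists w' => //; rewrite ltW.
pose Z k := [set z | `|z| <= n%:R /\ exists2 w', `|w - w'| <= k.+1%:R^-1 & E z w' n%:R].
have [||||z Zz [l zl]] := @nested_convex_cvg R X Z n%:R.
- move=> k; have [|w' [z [zn Ez]] ww'] := near_w k.+1%:R^-1; first by rewrite invr_gt0.
  by exists z; split => //; exists w'.
- move=> i j ij z [zn [w' ww' Ez]]; split => //; exists w' => //.
  by rewrite (le_trans ww')// lef_pV2 ?posrE// ler_nat.
- move=> k u v [un [w' ww' Ew']] [vn [w'' ww'' Ew'']].
  have h12 : 0 <= (2^-1 : R) <= 1 by lra.
  have hE (V : lmodType R) (p q : V) : 2^-1 *: (p + q) = 2^-1 *: p + (1 - 2^-1) *: q.
    by rewrite scalerDr; congr (_ + _ *: _); field.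
  rewrite hE; split; first exact: normr_conv_le.
  exists (2^-1 *: w' + (1 - 2^-1) *: w'').
    have -> : w - (2^-1 *: w' + (1 - 2^-1) *: w'') =
        2^-1 *: (w - w') + (1 - 2^-1) *: (w - w'').
      by rewrite !scalerBr addrACA -scalerDl (addrC 2^-1) subrK scale1r opprD.
    exact: normr_conv_le.
  by have := Econv h12 Ew' Ew''; rewrite -mulrDl (addrC 2^-1) subrK mul1r.
- by move=> z [].
have /choice[w' w'P] : forall k, exists w', `|w - w'| <= k.+1%:R^-1 /\ E (z k) w' n%:R.
  by move=> k; have [_ [w' ww' Ew']] := Zz k; exists w'.
exists l; split; last first.
  apply: (Ecl zl (w := w') (l' := w)); last by move=> k; case: (w'P k).
  apply/cvgrPdist_le => e e0.
  have [k1 _ h] := near_infty_natSinv_lt (PosNum e0).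
  by exists k1 => // k /= k1k; have [hk _] := w'P k; rewrite (le_trans hk)// ltW// h.
rewrite -lee_fin; apply: (lsc_le_lim (f := fun z : X => (`|z|)%:E) _ zl).
  by apply: lsc_cont; exact: norm_continuous.
move=> e e0; near=> k; have [zn _] := Zz k.
by rewrite lee_fin (le_trans zn)// lerDl ltW.
Unshelve. all: by end_near.
Qed.

Let C_absorb s : S s -> exists n, C n (n.+1%:R^-1 *: s).
Proof.
move=> Ss; have [t [z [r [t0 Ez]]]] := SE Ss.
(* [b] dominates the data of both witnesses, at [t *: s] and at 0, and its last term ensures
   [a <= 1] below. *)
pose b := `|z| + `|r| + `|x| + `|mu| + t^-1.
pose n := (Num.truncn b).+1; exists n.
have bn : b <= n%:R := ltW (truncnS_gt b).
have ti : 0 < t^-1 by rewrite invr_gt0.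
have [z0 r0 x0 m0] : [/\ 0 <= `|z|, 0 <= `|r|, 0 <= `|x| & 0 <= `|mu|] by [].
have zn : `|z| <= n%:R by move: bn; rewrite /b; lra.
have xn : `|x| <= n%:R by move: bn; rewrite /b; lra.
have rn : r <= n%:R by have := ler_norm r; move: bn; rewrite /b; lra.
have mn : mu <= n%:R by have := ler_norm mu; move: bn; rewrite /b; lra.
have tn : t^-1 <= n.+1%:R.
  by rewrite -natr1; move: bn; rewrite /b; lra.
pose a := n.+1%:R^-1 * t^-1.
have a01 : 0 <= a <= 1.
  apply/andP; split; first by rewrite mulr_ge0// ltW.
  by rewrite /a mulrC ler_pdivrMr ?ltr0Sn// mul1r.
have -> : n.+1%:R^-1 *: s = a *: (t *: s) + (1 - a) *: 0.
  by rewrite scaler0 addr0 scalerA mulfVK// gt_eqF.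
by apply: C_conv => //; [exists z|exists x]; split => //; [exact: Eup Ez|exact: Eup Ex].
Qed.

(** Composing with the projection onto [S] gives a closed cover of all of [Y], to which Baire's
    theorem applies; the ball obtained is then recentred at 0. *)
Let C_ball : exists n (d : R), 0 < d /\ forall w, S w -> `|w| < d -> C n w.
Proof.
have [P [Pcont PS PD]] := projection_exists Scl S0 Slin.
pose Q n := [set w | C n (n.+1%:R^-1 *: P w)].
have Qcl n : closed (Q n).
  apply: (@closed_comp _ _ (fun w => n.+1%:R^-1 *: P w)); last exact: C_closed.
  by move=> w _; apply: cvgZr; exact: Pcont.
have [n nQ] : exists n, ~ dense (~` Q n).
  apply: contrapT => h.
  have dQ n : open (~` Q n) /\ dense (~` Q n).
    split; first exact: closed_openC.
    by apply: contrapT => ?; apply: h; exists n.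
  have [|w [_ Qw]] := Baire dQ (O := setT) _ openT; first by exists 0.
  by have [n Cn] := C_absorb (PS w); apply: (Qw n).
have [U [[w0 Uw0] [Uo UQ]]] : exists U : set Y, U !=set0 /\ (open U /\ U `<=` Q n).
  apply: contrapT => h; apply: nQ => U U0 Uo; apply: contrapT => h2.
  apply: h; exists U; do 2!split => //; move=> w Uw; apply: contrapT => nQw.
  by apply: h2; exists w.
have /nbhs_ballP[e /= e0 eU] : nbhs w0 U by exact: open_nbhs_nbhs.
pose s0 := n.+1%:R^-1 *: P w0.
have Ss0 : S s0 by rewrite -[s0]addr0; exact: Slin.
have ball1 d : S d -> `|d| < e / n.+1%:R -> C n (s0 + d).
  move=> Sd de.
  have Snd : S (n.+1%:R *: d) by rewrite -[_ *: d]addr0; exact: Slin.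
  have : Q n (w0 + n.+1%:R *: d).
    apply/UQ/eU; rewrite -ball_normE /= opprD addNKr normrN normrZ ger0_norm//.
    by rewrite mulrC -ltr_pdivlMr.
  by rewrite /Q /= PD// scalerDr scalerA mulVf ?pnatr_eq0// scale1r.
clearbody s0.
have Sms0 : S (- s0) by rewrite -scaleN1r -[_ *: _]addr0; exact: Slin.
have [t [z [r [t0 Ez]]]] := SE Sms0; have [m Cm] := C_mem Ez.
(* This weight satisfies [a = (1 - a) t], so the centre [s0] cancels against [t *: - s0]. *)
pose a := t / (1 + t).
have t1 : 0 < 1 + t by rewrite addr_gt0.
have a0 : 0 < a by rewrite divr_gt0.
have a1 : a <= 1 by rewrite /a ler_pdivrMr// mul1r lerDr.
exists (maxn n m), (a * (e / n.+1%:R)); split.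
  by rewrite !mulr_gt0// invr_gt0.
move=> w Sw wd.
have -> : w = a *: (s0 + a^-1 *: w) + (1 - a) *: (t *: - s0).
  rewrite scalerDr !scalerA mulfV ?gt_eqF// scale1r scalerN -scaleNr addrAC.
  rewrite -scalerDl (_ : a + _ = 0) ?scale0r ?add0r// /a; field.
  by rewrite gt_eqF.
apply: C_conv; first by rewrite ltW.
  apply: (C_mono (leq_maxl n m)); apply: ball1.
    by rewrite -[_ *: w]addr0; exact: Slin.
  by rewrite normrZ gtr0_norm ?invr_gt0// mulrC ltr_pdivrMr// mulrC.
exact: (C_mono (leq_maxr n m)).
Qed.

(** 0 is a convex combination of [w] and a point of the ball in the opposite direction. The value is
    at least [mu] at 0 and at most [n] on the ball, which bounds it below at [w]. *)
Lemma value_lower_bound : exists2 K : R, 0 <= K &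
  forall z w r, E z w r -> mu - K * `|w| <= r.
Proof.
have [n [d [d0 Cd]]] := C_ball.
exists (`|n%:R - mu| / (d / 2)); first by rewrite !divr_ge0// ltW.
move=> z w r Ez; have [w0|w0] := eqVneq w 0.
  by rewrite w0 normr0 mulr0 subr0; apply: (@Emin z); rewrite -w0.
have wp : 0 < `|w| by rewrite normr_gt0.
have Sw := ES Ez.
set e := d / 2; have e0 : 0 < e by rewrite divr_gt0.
have [z' [_ Ez']] : C n (- (e / `|w|) *: w).
  apply: Cd; first by rewrite -[_ *: w]addr0; exact: Slin.
  rewrite normrZ normrN gtr0_norm ?divr_gt0// divfK ?gt_eqF//.
  by rewrite /e; lra.
set a := e / (e + `|w|).
have ew : 0 < e + `|w| by rewrite addr_gt0.
have a01 : 0 <= a <= 1.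
  apply/andP; split; first by rewrite divr_ge0// ltW.
  by rewrite /a ler_pdivrMr// mul1r lerDl ltW.
have := Econv a01 Ez Ez'.
have -> : a *: w + (1 - a) *: (- (e / `|w|) *: w) = 0.
  rewrite scalerA -scalerDl (_ : a + _ = 0) ?scale0r// /a; field.
  by rewrite !gt_eqF.
move=> /Emin h.
have {}h : (e + `|w|) * mu <= e * r + `|w| * n%:R.
  rewrite -(ler_pM2l ew) in h; apply: (le_trans h).
  by rewrite le_eqVlt; apply/orP; left; apply/eqP; rewrite /a; field; rewrite gt_eqF.
have nm := ler_norm (n%:R - mu).
rewrite lerBlDr -(ler_pM2l e0) mulrDr.
have -> : e * (`|n%:R - mu| / e * `|w|) = `|n%:R - mu| * `|w|.
  by field; rewrite gt_eqF.
have : (n%:R - mu) * `|w| <= `|n%:R - mu| * `|w| by rewrite ler_wpM2r.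
lra.
Qed.

(* The sublinear function [P] below is, up to the penalty [K * `|_|], the
   directional derivative at 0 of the value function [w |-> inf_z Phi z w]. *)
Lemma value_subgradient : exists v, forall z w r, E z w r -> mu + inner w v <= r.
Proof.
have [K K0 Kb] := value_lower_bound.
(* Taking [l = 0] shows that [A d] is nonempty even for [d] outside [S]; the slope [K] of the
   penalty keeps its infimum finite. *)
pose A d := [set a | exists l z w r,
  [/\ 0 <= l, E z w r & a = l * (r - mu) + K * `|d - l *: w|]].
pose P d := inf (A d).
have Alb d a : A d a -> - (K * `|d|) <= a.
  move=> [l [z [w [r [l0 Ez ->]]]]].
  have h1 := ler_wpM2l l0 (Kb _ _ _ Ez).
  have h2 : l * `|w| <= `|d| + `|d - l *: w|.
    have -> : l * `|w| = `|l *: w| by rewrite normrZ ger0_norm.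
    by have := ler_normB d (d - l *: w); rewrite subKr.
  have := ler_wpM2l K0 h2; nra.
have A0 d : A d (K * `|d|).
  by exists 0, x, 0, mu; split => //; rewrite mul0r add0r scale0r subr0.
have Ainf d : has_inf (A d).
  by split; [exists (K * `|d|)|exists (- (K * `|d|)) => a /Alb].
have Ple d a : A d a -> P d <= a by move=> ?; apply: ge_inf => //; case: (Ainf d).
have leP d b : (forall a, A d a -> b <= a) -> b <= P d.
  by move=> h; apply: lb_le_inf; [case: (Ainf d)|].
have PD d d' : P (d + d') <= P d + P d'.
  rewrite -lerBlDr; apply: (leP) => a Aa; rewrite lerBlDr (addrC a) -lerBlDr.
  apply: leP => b Ab; rewrite lerBlDr.
  move: Aa Ab => [l [z [w [r [l0 Ez ->]]]]] [l' [z' [w' [r' [l'0 Ez' ->]]]]].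
  have [ll|ll] := eqVneq (l + l') 0.
    have l00 : l = 0 by lra.
    have l'00 : l' = 0 by lra.
    rewrite l00 l'00 !mul0r !add0r !scale0r !subr0; apply: (le_trans (Ple _ _ (A0 _))).
    by rewrite -mulrDr ler_wpM2l// [leRHS]addrC ler_normD.
  have llp : 0 < l + l' by rewrite lt_neqAle eq_sym ll addr_ge0.
  (* The two multiples merge into one convex combination scaled by [l + l']. *)
  pose t := l / (l + l').
  have t01 : 0 <= t <= 1.
    apply/andP; split; first by rewrite divr_ge0// ltW.
    by rewrite /t ler_pdivrMr// mul1r lerDl.
  have tl : (l + l') * t = l by rewrite mulrC divfK.
  have tl' : (l + l') * (1 - t) = l' by rewrite mulrBr tl mulr1 addrAC subrr add0r.
  have Ezz := Econv t01 Ez Ez'.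
  apply: (@le_trans _ _ ((l + l') * (t * r + (1 - t) * r' - mu) +
      K * `|d + d' - (l + l') *: (t *: w + (1 - t) *: w')|)).
    by apply: Ple; exists (l + l'), (t *: z + (1 - t) *: z'),
      (t *: w + (1 - t) *: w'), (t * r + (1 - t) * r'); split; rewrite // ltW.
  rewrite scalerDr !scalerA tl tl' opprD addrACA.
  have := ler_wpM2l K0 (ler_normD (d - l *: w) (d' - l' *: w')).
  have -> : (l + l') * (t * r + (1 - t) * r' - mu) = l * (r - mu) + l' * (r' - mu).
    by rewrite /t; field.
  lra.
have PZle t d : 0 < t -> P (t *: d) <= t * P d.
  move=> t0; rewrite mulrC -ler_pdivrMr//; apply: leP => a [l [z [w [r [l0 Ez ->]]]]].
  rewrite ler_pdivrMr//; apply: Ple; exists (t * l), z, w, r; split => //.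
    by rewrite mulr_ge0// ltW.
  by rewrite -scalerA -scalerBr normrZ gtr0_norm//; ring.
have PZ t d : 0 < t -> P (t *: d) = t * P d.
  move=> t0; apply/eqP; rewrite eq_le PZle//=.
  have ti : 0 < t^-1 by rewrite invr_gt0.
  have := PZle t^-1 (t *: d) ti.
  by rewrite scalerA mulVf ?gt_eqF// scale1r mulrC ler_pdivlMr// mulrC.
have Pcont : continuous (P : Y -> R^o).
  apply: (@lipschitz_cont _ _ _ _ K) => d d'; rewrite ler_norml.
  have := PD (d - d') d'; rewrite subrK; have := Ple _ _ (A0 (d - d')).
  have := PD (d' - d) d; rewrite subrK; have := Ple _ _ (A0 (d' - d)).
  rewrite (distrC d'); lra.
have [v vP] := sublinear_subgradient Pcont PD PZ.
exists v => z w r Ez; rewrite addrC -lerBrDr; apply: (le_trans (vP w)).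
apply: Ple; exists 1, z, w, r; split => //.
by rewrite mul1r scale1r subrr normr0 mulr0 addr0.
Qed.

End ValueFunction.

(** * Sum rule *)

Section SumRule.
Context {R : realType} {X Y : hilbertType R} (A : X -> Y) (B : Y -> X).
Context (F : X -> \bar R) (k : Y -> \bar R).
Context (adjAB : forall x y, inner (A x) y = inner x (B y)) (Acont : continuous A).
Context (GF : Gamma0 F) (Gk : Gamma0 k).
Context (cq : sri (minkowski_sub (dom k) (A @` dom F)) 0).

(** The tilt by [u] turns [u] being a subgradient at [x] into minimality of [x] for [w = 0]. *)
Let E u z w (r : R) := (F z + k (A z + w)%R <= (r + inner z u)%:E)%E.

Let F0 : forall x, (-oo < F x)%E. Proof. by case: GF. Qed.
Let k0 : forall x, (-oo < k x)%E. Proof. by case: Gk. Qed.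

Let E_fin u z w r : E u z w r ->
  exists a b : R, [/\ F z = a%:E, k (A z + w) = b%:E & a + b <= r + inner z u].
Proof. exact: add_leE. Qed.

Let E_conv u z z' w w' r r' t : 0 <= t <= 1 -> E u z w r -> E u z' w' r' ->
  E u (t *: z + (1 - t) *: z') (t *: w + (1 - t) *: w') (t * r + (1 - t) * r').
Proof.
move=> t01 /E_fin[a [b [Fz kw ab]]] /E_fin[a' [b' [Fz' kw' ab']]].
have h1 := @convex_le _ _ F z z' t a a' GF t01.
have h2 := @convex_le _ _ k (A z + w) (A z' + w') t b b' Gk t01.
rewrite Fz Fz' kw kw' !lexx in h1 h2.
have /andP[t0 t1] := t01.
rewrite /E (adj_add adjAB) !(adj_scale adjAB) addrACA -!scalerDr.
apply: (le_trans (leeD (h1 isT isT) (h2 isT isT))); rewrite -EFinD lee_fin.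
by rewrite !innerE; nra.
Qed.

Let E_lim u (z : nat -> X) (w : nat -> Y) l l' r : z @ \oo --> l ->
  w @ \oo --> l' -> (forall n, E u (z n) (w n) r) -> E u l l' r.
Proof.
move=> zl wl h.
pose G (p : X * Y) := (F p.1 + k (A p.1 + p.2)%R)%E.
have Glsc : lower_semicontinuous G.
  apply: lsc_add => //.
    by apply: lsc_comp; [move=> p; exact: cvg_fst|case: GF].
  apply: (@lsc_comp _ _ _ k (fun p : X * Y => A p.1 + p.2)); last by case: Gk.
  move=> p; apply: cvgD; last exact: cvg_snd.
  by apply: (@continuous_comp _ _ _ fst A); [exact: cvg_fst|exact: Acont].
apply: (@lsc_le_lim _ _ G (fun n => (z n, w n)) (l, l') _ Glsc); first exact: cvg_pair.
move=> e e0.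
have /cvgrPdist_lt/(_ _ e0) : (inner (z n) u : R^o) @[n --> \oo] --> (inner l u : R^o).
  exact: (cvg_comp _ _ zl (@inner_continuousl _ _ u l)).
apply: filterS => n hn; apply: (le_trans (h n)); rewrite lee_fin -addrA lerD2l.
by move: hn; rewrite ltr_norml; lra.
Qed.

(** A subgradient [v] of the value function at 0 acts as a multiplier: varying the argument of [F]
    alone gives [u - B v], varying that of [k] alone gives [v]. *)
Lemma subdiff_add_comp x u :
  subdiff (fun z => F z + k (A z))%E x u <->
  exists a b, [/\ subdiff F x a, subdiff k (A x) b & u = a + B b].
Proof.
split => [sub|[a [b [sa sb ->]]] z]; last first.
  have [r Fx] := subdiff_fin GF sa; have [s kx] := subdiff_fin Gk sb.
  have h1 := sa z; have h2 := sb (A z).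
  apply: le_trans (leeD h1 h2); rewrite Fx kx -!EFinD lee_fin.
  by rewrite !innerE -!adjAB; lra.
have [C0 [Kcl [K0 Klin]]] := cq; set K := cone _ in Kcl K0 Klin.
have KE w : K w <-> exists t y z,
    [/\ 0 < t, dom k y, dom F z & w = t *: (y - A z)].
  split=> [[t t0 [_ [_ [y ky [_ [z Fz <-] <-]] [_ -> <-]] ->]]|
    [t [y [z [t0 ky Fz ->]]]]].
    by exists t, y, z; rewrite subr0.
  exists t => //; exists (y - A z) => //; exists (y - A z); last first.
    by exists 0; rewrite ?subr0.
  by exists y => //; exists (A z) => //; exists z.
have [y0 ky0 [_ [z0 Fz0 <-] yz0]] := C0.
(* The membership of 0 in the difference set supplies a point where the sum is finite, so it is
   finite at [x] too. *)
have [r [s [Fx kx]]] : exists r s, F x = r%:E /\ k (A x) = s%:E.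
  have := sub z0; rewrite -(subr0_eq yz0); move: ky0 Fz0; rewrite /dom /=.
  have := F0 x; have := k0 (A x); have := F0 z0; have := k0 y0.
  case: (F z0) => [b| |]//; case: (k y0) => [c| |]//.
  by case: (F x) => [r| |]//; case: (k (A x)) => [s| |]//; exists r, s.
have [||||||||||v vP] := @value_subgradient _ X Y (E u) x (r + s - inner x u) K.
- exact: E_conv.
- by move=> z w q q' qq' h; apply: (le_trans h); rewrite lee_fin lerD2r.
- exact: E_lim.
- by rewrite /E addr0 Fx kx lee_fin; lra.
- move=> z q; rewrite /E addr0 => /(le_trans (sub z)).
  by rewrite Fx kx lee_fin !innerE; lra.
- exact: Kcl.
- by move: K0; rewrite inE.
- move=> a w w' Kw Kw'; have := Klin a w w'.
  by rewrite !inE; apply.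
- move=> z w q /E_fin[a [b [Fz kw _]]]; apply/KE; exists 1, (A z + w), z.
  by split; rewrite /dom /= ?Fz ?kw ?ltry// scale1r addrC addKr.
- move=> w /KE[t [y [z [t0 ky Fz ->]]]].
  have [a Fa] : exists a, F z = a%:E.
    by move: (F0 z) Fz; rewrite /dom /=; case: (F z) => // a; exists a.
  have [b kb] : exists b, k y = b%:E.
    by move: (k0 y) ky; rewrite /dom /=; case: (k y) => // b; exists b.
  exists t^-1, z, (a + b - inner z u); split; first by rewrite invr_gt0.
  by rewrite /E scalerA mulVf ?gt_eqF// scale1r (addrC (A z)) subrK Fa kb subrK -EFinD.
(* The change of variable [w = y - A z] makes the arguments of [F] and [k] independent. *)
have key z y a b : F z = a%:E -> k y = b%:E ->
    r + s - inner x u + inner (y - A z) v <= a + b - inner z u.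
  move=> Fa kb; apply: (vP z).
  by rewrite /E (addrC (A z)) subrK Fa kb subrK -EFinD.
exists (u - B v), v; split; last by rewrite subrK.
  move=> z; have := F0 z; case Fz : (F z) => [a| |]// _; last by rewrite leey.
  have := key _ _ _ _ Fz kx; rewrite Fx lee_fin !innerE -!adjAB; lra.
move=> y; have := k0 y; case ky : (k y) => [b| |]// _; last by rewrite leey.
have := key _ _ _ _ Fx ky; rewrite kx lee_fin !innerE; lra.
Qed.

End SumRule.

(** * Parallel sums as proximity operators *)

Section ParallelSum.
Context {R : realType} {G K : hilbertType R} (M : {linear K -> G}).
Context (f g : G -> \bar R) (h : K -> \bar R).
Context (Mb : bounded_operator M) (Gf : Gamma0 f) (Gg : Gamma0 g) (Gh : Gamma0 h).
Context (cq_h : sri (minkowski_sub (dom (conjugate h))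
  (adjoint M @` (dom f `&` dom (conjugate g)))) 0).
Context (cq_fg : sri (minkowski_sub (dom f) (dom (conjugate g))) 0).

Let phi z := (f z + conjugate g z + conjugate h (adjoint M z))%E.

Let adjM x y : inner (adjoint M x) y = inner x (M y).
Proof. by rewrite innerC -adjointP// innerC. Qed.

Let adjM_continuous : continuous (adjoint M).
Proof.
have [c Mc] := Mb; apply: (@adj_continuous _ _ _ M _ c) => //.
by move=> x y; exact: adjointP.
Qed.

Let dom_inter : exists z, (dom f `&` dom (conjugate g)) z /\
  dom (conjugate h) (adjoint M z).
Proof.
have [[y hy [_ [z fgz <-] yz]] _] := cq_h.
by exists z; split => //; rewrite -(subr0_eq yz).
Qed.

Let GFG : Gamma0 (fun z => f z + conjugate g z)%E.
Proof.
apply: Gamma0_add => //; first exact: Gamma0_conjugate.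
by have [z [fgz _]] := dom_inter; exists z.
Qed.

Lemma Gamma0_sum_comp : Gamma0 phi.
Proof.
have [z [fgz hz]] := dom_inter.
have [f0 _ _ _] := Gf; have [g0 _ _ _] := Gamma0_conjugate Gg.
apply: Gamma0_add => //; last by exists z; split => //; rewrite dom_add.
apply: (@Gamma0_comp _ _ _ (adjoint M) (conjugate h)).
- exact: Gamma0_conjugate.
- exact: adjM_continuous.
- exact: (adj_add adjM).
- exact: (adj_scale adjM).
- by exists z.
Qed.

Lemma subdiff_sum_comp p u : subdiff phi p u <->
  exists a b c, [/\ subdiff f p a, subdiff (conjugate g) p b,
    subdiff (conjugate h) (adjoint M p) c & u = a + b + M c].
Proof.
have [f0 _ _ _] := Gf; have [g0 _ _ _] := Gamma0_conjugate Gg.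
have cq1 : sri (minkowski_sub (dom (conjugate h))
    (adjoint M @` dom (fun z => f z + conjugate g z)%E)) 0 by rewrite dom_add.
have cq2 : sri (minkowski_sub (dom f) (id @` dom (conjugate g))) 0 by rewrite image_id.
have sum1 := subdiff_add_comp adjM adjM_continuous GFG (Gamma0_conjugate Gh) cq1.
(* Here [conjugate g] takes the role of [F] and [f] that of [k], to match the order of the
   difference in [cq_fg]. *)
have sum2 := @subdiff_add_comp _ _ _ id id _ _ (fun _ _ => erefl) (fun _ => cvg_id)
  (Gamma0_conjugate Gg) Gf cq2.
have fgE : (fun z => conjugate g z + f z)%E = (fun z => f z + conjugate g z)%E.
  by apply/funext => z; rewrite addeC.
rewrite fgE in sum2.
split=> [/sum1[ab [c [/sum2[b [a [sb sa ->]]] sc ->]]]|[a [b [c [sa sb sc ->]]]]].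
  by exists a, b, c; split => //; rewrite (addrC b).
apply/sum1; exists (a + b), c; split => //; apply/sum2.
by exists b, a; split => //; rewrite addrC.
Qed.

(** The inverse of [prox f] is the identity plus [subdiff f], and [subdiff g] and [subdiff h] have
    the subdifferentials of the conjugates as inverses. By the sum rule the left side is inverse to
    the identity plus [subdiff phi]. *)
Lemma parsum_prox :
  parsum (sv (prox f)) (parsum (subdiff g) (parcomp M (subdiff h))) = sv (prox phi).
Proof.
apply/funext => z; apply/seteqP; split => [p|_ ->].
  move=> [u pu [v [a ga [b [c [_ -> hc] ->] <-]] <-]].
  apply/esym/(proxP _ _ Gamma0_sum_comp)/subdiff_sum_comp.
  exists (u - p), a, c; split.
  - by apply/proxP => //; exact: esym pu.
  - exact: subdiff_conjugate_sub Gg ga.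
  - exact: subdiff_conjugate_sub Gh hc.
  - by rewrite [LHS]addrAC addrA.
set p := prox phi z.
have /subdiff_sum_comp[a [b [c [sa sb sc zp]]]] := subdiff_prox z Gamma0_sum_comp.
exists (a + p).
  by apply/esym/proxP => //; rewrite addrK.
exists (b + M c); last by rewrite addrAC addrA -zp subrK.
exists b; first by apply/(subdiff_conjugate _ _ Gg).
exists (M c) => //; exists c => //; exists (adjoint M p) => //.
by apply/(subdiff_conjugate _ _ Gh).
Qed.

End ParallelSum.

(** * Gradients that are proximity operators *)

Section Envelope.
Context {R : realType} {X : hilbertType R} (phi : X -> \bar R) (Gphi : Gamma0 phi).

(** This is [phi^* (z - p) + |p|^2 / 2] rewritten by the Fenchel-Young equality; [phi p] is finite,
    so [fine] loses nothing. *)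
Definition conj_env (z : X) : R :=
  let p := prox phi z in inner z p - `|p| ^+ 2 / 2 - fine (phi p).

Let phi_prox z : phi (prox phi z) = (fine (phi (prox phi z)))%:E.
Proof. by have [r ->] := subdiff_fin Gphi (subdiff_prox z Gphi). Qed.

(** The point [z - prox phi z], optimal for [z], is a candidate in the infimum at [y]. *)
Let infconv_conj_le z y :
  (infconv (conjugate phi) half_sq y <=
   (conj_env z + inner (y - z) (prox phi z) + `|y - z| ^+ 2 / 2)%:E)%E.
Proof.
have [f0 _ _ _] := Gphi.
apply: (@le_trans _ _ (conjugate phi (z - prox phi z)%R +
    half_sq (y - (z - prox phi z))%R)%E).
  by apply: ereal_inf_lbound; exists (z - prox phi z).
rewrite (conjugate_subdiff f0 (phi_prox z) (subdiff_prox z Gphi)) -EFinD lee_fin.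
rewrite /conj_env; set p := prox phi z.
rewrite -!inner_norm !innerE !(innerC p) !(innerC z y); lra.
Qed.

(** Fenchel-Young at [prox phi z], followed by completing the square. *)
Let infconv_conj_ge z y :
  ((conj_env z + inner (y - z) (prox phi z))%:E <=
   infconv (conjugate phi) half_sq y)%E.
Proof.
apply: le_ereal_inf_tmp => _ [v _ <-].
apply: le_trans (leeD2r _ (conjugate_ge v (phi_prox z))).
rewrite -EFinD lee_fin /conj_env; set p := prox phi z.
have := inner_ge0 (y - v - p).
rewrite -!inner_norm !innerE !(innerC p) !(innerC v y); lra.
Qed.

Lemma infconv_conj z : infconv (conjugate phi) half_sq z = (conj_env z)%:E.
Proof.
apply/eqP; rewrite eq_le; apply/andP; split.
  have := infconv_conj_le z z.
  by rewrite subrr inner0l normr0 expr0n mul0r !addr0.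
by have := infconv_conj_ge z z; rewrite subrr inner0l addr0.
Qed.

Lemma conj_env_ge z y : conj_env z + inner (y - z) (prox phi z) <= conj_env y.
Proof. by rewrite -lee_fin -infconv_conj. Qed.

Lemma conj_env_le z y :
  conj_env y <= conj_env z + inner (y - z) (prox phi z) + `|y - z| ^+ 2 / 2.
Proof. by rewrite -lee_fin -infconv_conj. Qed.

End Envelope.

(* The hypotheses on [psi] make it a convex function with gradient [T] for which
   [|.|^2/2 - psi] is also convex; expanding the latter as a supremum of its
   tangents exhibits [conjugate psi - |.|^2/2] as a supremum of affine functions. *)
Section GradientIsProx.
Context {R : realType} {X : hilbertType R} (psi : X -> R) (T : X -> X).
Context (psi_ge : forall z y, psi z + inner (y - z) (T z) <= psi y).
Context (psi_le : forall z y, psi y <= psi z + inner (y - z) (T z) + `|y - z| ^+ 2 / 2).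

Let F (u : X) : \bar R := (conjugate (fun y => (psi y)%:E) u - half_sq u)%E.

Let c z := `|T z| ^+ 2 / 2 - psi z.

Let F_le u (a : R) : (F u <= a%:E)%E <-> forall z, inner (z - T z) u + c z <= a.
Proof.
rewrite /F leeBlDr// -EFinD; split => [/conjugate_le h z|h].
  (* This point maximizes the tangent of [q - psi] at [z] minus the half square of the distance to
     [u]; the maximum is the affine function with constant [c z]. *)
  have := h (fun _ => ltNyr _) (u + (z - T z)) _ erefl.
  have := psi_le z (u + (z - T z)); rewrite /c.
  rewrite -!inner_norm !innerE !(innerC (T z)) !(innerC z u); lra.
apply/conjugate_le => [x|x _ [<-]]; first exact: ltNyr.
have := h x; have := inner_ge0 (u - T x); rewrite /c.
rewrite -!inner_norm !innerE !(innerC (T x)); lra.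
Qed.

Lemma Gamma0_conj_sub_half_sq : Gamma0 F.
Proof.
apply: (@Gamma0_affine_sup _ _ (range (fun z => (z - T z, c z)))).
- move=> u a; split => [/F_le h _ [z _ <-]|h]; first exact: h.
  by apply/F_le => z; apply: (h (z - T z, c z)); exists z.
- by exists (0 - T 0, c 0), 0.
(* [T 0] is a subgradient of [psi] at 0, so the conjugate is finite there. *)
- exists (T 0); rewrite /dom /=.
  apply: (@le_lt_trans _ _ (- psi 0 - `|T 0| ^+ 2 / 2)%:E); last exact: ltry.
  rewrite /F leeBlDr// -EFinD; apply/conjugate_le => [x|x _ [<-]]; first exact: ltNyr.
  by have := psi_ge 0 x; rewrite !innerE; lra.
Qed.

(** The affine minorant indexed by [x] has slope [x - T x] and is exact at [T x]. *)
Lemma prox_conj_sub_half_sq : prox F = T.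
Proof.
apply/funext => x; apply/proxP; first exact: Gamma0_conj_sub_half_sq.
move=> y; have [F0 _ _ _] := Gamma0_conj_sub_half_sq.
have FTx : F (T x) = (inner x (T x) - psi x - `|T x| ^+ 2 / 2)%:E.
  rewrite /F (conjugate_subdiff (x := x) (r := psi x))// => z; first exact: ltNyr.
  by rewrite lee_fin addrC.
have := F0 y; case Fy : (F y) => [a| |]// _; last by rewrite leey.
have := (F_le y a).1; rewrite Fy lexx => /(_ isT x).
by rewrite FTx lee_fin /c -!inner_norm !innerE !(innerC (T x)) !(innerC y x); lra.
Qed.

End GradientIsProx.

(** * Operator norms, single-valued operators and the weighted sum *)

Lemma opnorm_le {R : realType} {X Y : hilbertType R} (L : {linear X -> Y}) x :
  bounded_operator L -> `|L x| <= opnorm L * `|x|.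
Proof.
move=> [b Lb]; have [->|x0] := eqVneq x 0; first by rewrite linear0 !normr0 mulr0.
have xp : 0 < `|x| by rewrite normr_gt0.
rewrite -ler_pdivrMr//; apply: ub_le_sup.
  exists `|b| => _ [y /= y1 <-]; apply: (le_trans (Lb y)).
  by rewrite (le_trans (ler_wpM2r _ (ler_norm b)))// ler_piMr.
exists (`|x|^-1 *: x); first by rewrite /= normrZ normfV normr_id mulVf ?gt_eqF.
by rewrite linearZ normrZ normfV normr_id mulrC.
Qed.

Section SetValuedSingle.
Context {R : pzRingType}.

Lemma svcomp_sv {X Y Z : Type} (B : Y -> Z) (A : X -> Y) :
  svcomp (sv B) (sv A) = sv (B \o A).
Proof.
apply/funext => x; apply/seteqP; split => [_ [_ -> ->]|_ ->] //.
by exists (A x).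
Qed.

Lemma svscale_sv {X : Type} {Y : lmodType R} (a : R) (A : X -> Y) :
  svscale a (sv A) = sv (fun x => a *: A x).
Proof.
apply/funext => x; apply/seteqP; split => [_ [_ -> <-]|_ ->] //.
by exists (A x).
Qed.

Lemma svsum_sv {I : finType} {X : Type} {Y : zmodType} (A : I -> X -> Y) :
  svsum (fun i => sv (A i)) = sv (fun x => \sum_i A i x).
Proof.
apply/funext => x; apply/seteqP; split => [_ [u uA <-]|_ ->].
  by apply: eq_bigr => i _; exact: uA.
by exists (fun i => A i x).
Qed.

End SetValuedSingle.

Theorem proposition3p9 (R : realType) (H : hilbertType R) (I : finType)
    (I_neq0 : (0 < #|I|)%N)
    (w : I -> R) (G K : I -> hilbertType R)
    (L : forall i, {linear H -> G i}) (M : forall i, {linear K i -> G i})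
    (f g : forall i, G i -> \bar R) (h : forall i, K i -> \bar R)
    (w_gt0 : forall i, 0 < w i)
    (L_bounded : forall i, bounded_operator (L i))
    (L_neq0 : forall i, exists x, L i x <> 0)
    (M_bounded : forall i, bounded_operator (M i))
    (M_neq0 : forall i, exists x, M i x <> 0)
    (f_Gamma0 : forall i, Gamma0 (f i))
    (g_Gamma0 : forall i, Gamma0 (g i))
    (h_Gamma0 : forall i, Gamma0 (h i))
    (wL_le1 : \sum_i w i * opnorm (L i) ^+ 2 <= 1)
    (cq_h : forall i,
      sri (minkowski_sub (dom (conjugate (h i)))
                (adjoint (M i) @` (dom (f i) `&` dom (conjugate (g i))))) 0)
    (cq_fg : forall i, sri (minkowski_sub (dom (f i)) (dom (conjugate (g i)))) 0) :
  let T : H -> set H :=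
    svsum (fun i => svscale (w i)
      (svcomp (sv (adjoint (L i)))
        (svcomp (parsum (sv (prox (f i)))
                        (parsum (subdiff (g i)) (parcomp (M i) (subdiff (h i)))))
                (sv (L i))))) in
  let fT : H -> \bar R := fun x =>
    (conjugate (fun y =>
       \sum_i (w i)%:E *
         infconv (conjugate (fun z => f i z + conjugate (g i) z
                                 + conjugate (h i) (adjoint (M i) z)))
                 half_sq (L i y)) x
     - half_sq x)%E in
  (exists2 S : H -> H, T = sv S & prox_class S) /\
  (Gamma0 fT /\ T = sv (prox fT)).
Proof.
move=> T fT.
pose phi i z := (f i z + conjugate (g i) z + conjugate (h i) (adjoint (M i) z))%E.
have Gphi i : Gamma0 (phi i) by exact: Gamma0_sum_comp.
(* [S] is the single-valued form of [T]; [psi_ge] and [psi_le] below make it the gradient of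
   [psi]. *)
pose S x := \sum_i w i *: adjoint (L i) (prox (phi i) (L i x)).
pose psi x := \sum_i w i * conj_env (phi i) (L i x).
have TS : T = sv S.
  rewrite -svsum_sv /T; congr svsum; apply/funext => i.
  by rewrite parsum_prox// !svcomp_sv svscale_sv.
have innerS z y : inner (y - z) (S z) =
    \sum_i w i * inner (L i y - L i z) (prox (phi i) (L i z)).
  rewrite inner_sumr; apply: eq_bigr => i _.
  by rewrite innerZr -adjointP// linearB.
have psi_ge z y : psi z + inner (y - z) (S z) <= psi y.
  rewrite innerS -big_split; apply: ler_sum => i _ /=.
  by rewrite -mulrDr ler_wpM2l ?conj_env_ge// ltW.
have psi_le z y : psi y <= psi z + inner (y - z) (S z) + `|y - z| ^+ 2 / 2.
  apply: (@le_trans _ _ (psi z + inner (y - z) (S z) +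
      \sum_i w i * (`|L i y - L i z| ^+ 2 / 2))).
    rewrite innerS -!big_split; apply: ler_sum => i _ /=.
    by rewrite -!mulrDr ler_wpM2l ?conj_env_le// ltW.
  (* By [wL_le1], the weighted squares of the norms of the [L i d] sum to at most [|d|^2]. *)
  rewrite lerD2l; set d := y - z.
  apply: (@le_trans _ _ ((\sum_i w i * opnorm (L i) ^+ 2) * (`|d| ^+ 2 / 2)));
    last first.
    by rewrite ler_piMl// divr_ge0// exprn_ge0.
  rewrite mulr_suml; apply: ler_sum => i _.
  rewrite -linearB -mulrA ler_wpM2l ?(ltW (w_gt0 i))// mulrA ler_wpM2r ?invr_ge0//.
  have Ld := opnorm_le d (L_bounded i).
  by rewrite -exprMn lerXn2r ?nnegrE// (le_trans _ Ld).
have psiE : (fun y => \sum_i (w i)%:E * infconv (conjugate (phi i)) half_sq (L i y))%E =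
    fun y => (psi y)%:E.
  apply/funext => y; rewrite -sumEFin; apply: eq_bigr => i _.
  by rewrite infconv_conj.
have fTE : fT = fun u => (conjugate (fun y => (psi y)%:E) u - half_sq u)%E.
  by rewrite -psiE.
have GfT : Gamma0 fT by rewrite fTE; exact: (Gamma0_conj_sub_half_sq psi_ge psi_le).
have proxfT : prox fT = S by rewrite fTE; exact: (prox_conj_sub_half_sq psi_ge psi_le).
by split; [exists S => //; exists fT|rewrite proxfT].
Qed.
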